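(* Let $(X,T)$ be a null dynamical system whose set of minimal points is dense in $X$. Then $(X,T)$ is mean equicontinuous.
   Context: A dynamical system $(X,T)$ is a compact metric space $(X,d)$ with a continuous map $T:X\to X$. A point $y$ is minimal if $(\overline{\{T^ky:k\ge0\}},T)$ is a minimal system (every orbit dense). $(X,T)$ is mean equicontinuous if for every $\epsilon>0$ there is $\delta>0$ such that $d(x,y)<\delta$ implies $\limsup_{n\to\infty}\frac1n\sum_{i=0}^{n-1}d(T^ix,T^iy)<\epsilon$. For an increasing sequence $A=\{0\le t_1<t_2<\cdots\}\subseteq\mathbb{Z}_+$ and a finite open cover $\mathcal U$, $h^A_{top}(T,\mathcal U)=\limsup_{n\to\infty}\frac1n\log N(\bigvee_{i=1}^nT^{-t_i}\mathcal U)$, where $N(\cdot)$ is the minimal cardinality of a subcover, and $h^A_{top}(T)=\sup_{\mathcal U}h^A_{top}(T,\mathcal U)$. $(X,T)$ is null if $h^A_{top}(T)=0$ for every increasing sequence $A$. *)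

(* Defs.v *)
From Stdlib Require Import Reals Lra List.
Open Scope R_scope.

Section Dyn.
Variable X : Type.
Variable d : X -> X -> R.

Definition is_metric : Prop :=
  (forall x y, 0 <= d x y) /\ (forall x y, d x y = 0 <-> x = y) /\
  (forall x y, d x y = d y x) /\ (forall x y z, d x z <= d x y + d y z).

Definition is_open (U : X -> Prop) : Prop :=
  forall x, U x -> exists r, 0 < r /\ forall y, d x y < r -> U y.

Definition is_compact : Prop :=
  forall (I : Type) (U : I -> X -> Prop),
    (forall i, is_open (U i)) -> (forall x, exists i, U i x) ->
    exists l : list I, forall x, exists i, In i l /\ U i x.

Definition continuous_map (T : X -> X) : Prop :=
  forall x eps, 0 < eps -> exists delta, 0 < delta /\
    forall y, d x y < delta -> d (T x) (T y) < eps.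

Definition in_closure (S : X -> Prop) (z : X) : Prop :=
  forall eps, 0 < eps -> exists s, S s /\ d z s < eps.

Definition orbit (T : X -> X) (y : X) : X -> Prop :=
  fun z => exists k : nat, z = Nat.iter k T y.

Definition minimal_point (T : X -> X) (y : X) : Prop :=
  let Y := in_closure (orbit T y) in
  forall z, Y z -> forall w, Y w -> in_closure (orbit T z) w.

Definition minimal_points_dense (T : X -> X) : Prop :=
  forall x eps, 0 < eps -> exists y, minimal_point T y /\ d x y < eps.

(** limsup conditions in the extended reals, unfolded *)
Definition limsup_lt (a : nat -> R) (c : R) : Prop :=
  exists c', c' < c /\ exists N, forall n, (N <= n)%nat -> a n <= c'.
Definition limsup_le (a : nat -> R) (c : R) : Prop :=
  forall c', c < c' -> exists N, forall n, (N <= n)%nat -> a n < c'.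

Fixpoint rsum (f : nat -> R) (n : nat) : R :=
  match n with O => 0 | S m => rsum f m + f m end.

Definition mean_equicontinuous (T : X -> X) : Prop :=
  forall eps, 0 < eps -> exists delta, 0 < delta /\
    forall x y, d x y < delta ->
      limsup_lt (fun n => / INR n * rsum (fun i => d (Nat.iter i T x) (Nat.iter i T y)) n) eps.

Definition open_cover (U : list (X -> Prop)) : Prop :=
  (forall V, In V U -> is_open V) /\ (forall x, exists V, In V U /\ V x).

(** V is an element of the join  \/_{i=1}^n T^{-t_i} U, where the increasing
    sequence is t 0 < t 1 < ... (t 0 plays the role of t_1). *)
Definition join_elem (T : X -> X) (t : nat -> nat) (U : list (X -> Prop)) (n : nat)
  (V : X -> Prop) : Prop :=
  exists f : nat -> nat, (forall i, (i < n)%nat -> (f i < length U)%nat) /\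
    forall x, V x <-> forall i, (i < n)%nat -> nth (f i) U (fun _ => False) (Nat.iter (t i) T x).

Definition subcover_card (C : (X -> Prop) -> Prop) (k : nat) : Prop :=
  exists l : list (X -> Prop), length l = k /\ Forall C l /\
    forall x, exists V, In V l /\ V x.

Definition is_N (C : (X -> Prop) -> Prop) (k : nat) : Prop :=
  subcover_card C k /\ forall k', subcover_card C k' -> (k <= k')%nat.

(** h^A_top(T,U) = limsup (1/n) log N(join) is <= 0 (hence = 0, as it is >= 0) *)
Definition seq_entropy_cover_zero (T : X -> X) (t : nat -> nat) (U : list (X -> Prop)) : Prop :=
  forall Nseq : nat -> nat, (forall n, is_N (join_elem T t U n) (Nseq n)) ->
    limsup_le (fun n => / INR n * ln (INR (Nseq n))) 0.

Definition null_system (T : X -> X) : Prop :=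
  forall t : nat -> nat, (forall i, (t i < t (S i))%nat) ->
    forall U, open_cover U -> seq_entropy_cover_zero T t U.

End Dyn.

(* Main.v *)
(** If mean equicontinuity fails, there are arbitrarily close pairs (u, v) whose orbits are
    eps-apart on a set of times E(u, v) of upper density at least c. From these we build, for
    every m, pairs (u_1, v_1), ..., (u_m, v_m) and 2^m times realising all patterns "far/close".
    Suppose m pairs and a set S of 2^m times are given such that the sets
    {n : n + S is contained in E(u, v)} still have density at least c for arbitrarily close
    (u, v). Since minimal points are dense, finitely many tuples suffice so that at every time n
    one of them returns near (u_1, v_1, ..., u_m, v_m); this colours the times n. Choose
    successively close pairs and times r_0, r_1, ... such that the j-th pair is far apart on
    r_j + S, but so close that it is not yet separated on r_i + S for i < j. Two indices
    i < j of the same colour give m + 1 pairs and the times (r_i + S) and (r_j + S), and by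
    pigeonhole i and j can be chosen so that the density condition survives.

    For m = 2^n, duality gives n times at which all 2^n patterns are realised by pairs.
    Dropping small times, one concatenates such sets into one increasing sequence, along which
    the join of a fine cover has at least 2^(n/4) elements for infinitely many n: a pair lies
    in a product of two elements of the join, so the square of their number is at least
    2^(n/2). This contradicts nullness. *)

Require Import Defs.
From Stdlib Require Import Reals Lra Lia List Arith ClassicalEpsilon FinFun Sorted.
Import ListNotations.

(** * Indicators, counting and lists *)

Definition dec (P : Prop) : bool :=
  if excluded_middle_informative P then true else false.

Lemma dec_true (P : Prop) : dec P = true <-> P.
Proof. unfold dec; destruct excluded_middle_informative; intuition congruence. Qed.

Definition ind (P : Prop) : R := if excluded_middle_informative P then 1 else 0.

Lemma ind_true (P : Prop) : P -> ind P = 1.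
Proof. unfold ind; destruct excluded_middle_informative; tauto. Qed.

Lemma ind_false (P : Prop) : ~ P -> ind P = 0.
Proof. unfold ind; destruct excluded_middle_informative; tauto. Qed.

Lemma ind_bounds (P : Prop) : 0 <= ind P <= 1.
Proof. unfold ind; destruct excluded_middle_informative; lra. Qed.

Lemma rsum_le (f g : nat -> R) (n : nat) :
  (forall i, f i <= g i) -> rsum f n <= rsum g n.
Proof.
  intros H; induction n as [|n IH]; simpl; [lra|].
  specialize (H n); lra.
Qed.

Lemma rsum_nonneg (f : nat -> R) (n : nat) : (forall i, 0 <= f i) -> 0 <= rsum f n.
Proof.
  intros H; induction n as [|n IH]; simpl; [lra|].
  specialize (H n); lra.
Qed.

Lemma rsum_plus (f g : nat -> R) (n : nat) :
  rsum (fun i => f i + g i) n = rsum f n + rsum g n.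
Proof. induction n as [|n IH]; simpl; lra. Qed.

Lemma rsum_scal (a : R) (f : nat -> R) (n : nat) :
  rsum (fun i => a * f i) n = a * rsum f n.
Proof. induction n as [|n IH]; simpl; [lra|rewrite IH; lra]. Qed.

Lemma rsum_const (a : R) (n : nat) : rsum (fun _ => a) n = INR n * a.
Proof. induction n as [|n IH]; [simpl; lra|]. rewrite S_INR; simpl; lra. Qed.

Lemma rsum_add (f : nat -> R) (m n : nat) :
  rsum f (m + n) = rsum f m + rsum (fun i => f (i + m)%nat) n.
Proof.
  induction n as [|n IH]; simpl.
  - rewrite Nat.add_0_r; lra.
  - rewrite Nat.add_succ_r; simpl; rewrite IH, (Nat.add_comm n m); lra.
Qed.

(** Splitting the sum of the first [m + n] terms in two ways shows that the shift loses only the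
    first [m] terms, each at most 1. *)
Lemma rsum_shift_ge (f : nat -> R) (m n : nat) :
  (forall i, 0 <= f i <= 1) ->
  rsum f n - INR m <= rsum (fun i => f (i + m)%nat) n.
Proof.
  intros H.
  assert (H1 : rsum f (m + n) = rsum f m + rsum (fun i => f (i + m)%nat) n)
    by apply rsum_add.
  assert (H2 : rsum f (n + m) = rsum f n + rsum (fun i => f (i + n)%nat) m)
    by apply rsum_add.
  rewrite Nat.add_comm in H2.
  assert (H3 : 0 <= rsum (fun i => f (i + n)%nat) m)
    by (apply rsum_nonneg; intros; apply H).
  assert (H4 : rsum f m <= rsum (fun _ => 1) m) by (apply rsum_le; intros; apply H).
  rewrite rsum_const in H4; lra.
Qed.

Lemma rsum_ind_pos (P : nat -> Prop) (n : nat) :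
  0 < rsum (fun i => ind (P i)) n -> exists i, P i.
Proof.
  intros H; apply NNPP; intros H'.
  assert (rsum (fun i => ind (P i)) n <= rsum (fun _ => 0) n).
  { apply rsum_le; intros i; rewrite ind_false; [lra|]. intros Hi; apply H'; eauto. }
  rewrite rsum_const in *; lra.
Qed.

Definition lsum {A : Type} (f : A -> R) (l : list A) : R :=
  fold_right (fun a s => f a + s) 0 l.

Lemma lsum_app {A : Type} (f : A -> R) (l l' : list A) :
  lsum f (l ++ l') = lsum f l + lsum f l'.
Proof. induction l as [|a l IH]; simpl; [lra|]. rewrite IH; lra. Qed.

Lemma lsum_le_const {A : Type} (f : A -> R) (c : R) (l : list A) :
  (forall a, In a l -> f a <= c) -> lsum f l <= INR (length l) * c.
Proof.
  induction l as [|a l IH]; intros H; [simpl; lra|].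
  cbn [length]; rewrite S_INR; simpl.
  assert (f a <= c) by (apply H; now left).
  assert (lsum f l <= INR (length l) * c) by (apply IH; intros; apply H; now right).
  lra.
Qed.

Lemma lsum_ge_const {A : Type} (f : A -> R) (c : R) (l : list A) :
  (forall a, In a l -> c <= f a) -> INR (length l) * c <= lsum f l.
Proof.
  induction l as [|a l IH]; intros H; [simpl; lra|].
  cbn [length]; rewrite S_INR; simpl.
  assert (c <= f a) by (apply H; now left).
  assert (INR (length l) * c <= lsum f l) by (apply IH; intros; apply H; now right).
  lra.
Qed.

Lemma lsum_nonneg {A : Type} (f : A -> R) (l : list A) :
  (forall a, 0 <= f a) -> 0 <= lsum f l.
Proof. intros H; induction l as [|a l IH]; simpl; [lra|]. specialize (H a); lra. Qed.

Lemma rsum_lsum {A : Type} (f : A -> nat -> R) (l : list A) (n : nat) :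
  rsum (fun i => lsum (fun a => f a i) l) n = lsum (fun a => rsum (f a) n) l.
Proof.
  induction l as [|a l IH]; simpl.
  - rewrite rsum_const; lra.
  - rewrite rsum_plus, IH; reflexivity.
Qed.

Fixpoint pairs {A : Type} (l : list A) : list (A * A) :=
  match l with
  | [] => []
  | x :: l' => map (pair x) l' ++ pairs l'
  end.

Lemma length_pairs {A : Type} (l : list A) :
  (length (pairs l) <= length l * length l)%nat.
Proof. induction l as [|a l IH]; simpl; [lia|]. rewrite length_app, length_map; lia. Qed.

Lemma pairs_filter {A : Type} (f : A -> bool) (l : list A) (p : A * A) :
  In p (pairs (filter f l)) -> In p (pairs l).
Proof.
  induction l as [|a l IH]; simpl; [tauto|].
  rewrite in_app_iff; destruct (f a); simpl; [|tauto].
  rewrite in_app_iff; intros [H|H]; [|tauto].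
  left; apply in_map_iff in H as (b & <- & Hb); apply in_map.
  apply filter_In in Hb; tauto.
Qed.

Lemma pairs_In {A : Type} (l : list A) (x y : A) :
  In (x, y) (pairs l) -> In x l /\ In y l.
Proof.
  induction l as [|a l IH]; simpl; [tauto|].
  rewrite in_app_iff, in_map_iff; intros [(b & E & Hb)|H]; [|tauto].
  injection E as -> ->; tauto.
Qed.

(* With [s] sets containing the point, this is [s <= 1 + s (s - 1) / 2]. *)
Lemma lsum_ind_le_pairs {A : Type} (P : A -> Prop) (l : list A) :
  lsum (fun a => ind (P a)) l
  <= 1 + lsum (fun q => ind (P (fst q) /\ P (snd q))) (pairs l).
Proof.
  induction l as [|a l IH]; simpl; [lra|].
  rewrite lsum_app.
  assert (Hn : 0 <= lsum (fun q => ind (P (fst q) /\ P (snd q))) (pairs l))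
    by (apply lsum_nonneg; intros; apply ind_bounds).
  destruct (classic (P a)) as [Ha|Ha].
  - rewrite ind_true by assumption.
    enough (lsum (fun q => ind (P (fst q) /\ P (snd q))) (map (pair a) l)
            = lsum (fun a => ind (P a)) l) by lra.
    clear - Ha; induction l as [|b l IH]; simpl; [reflexivity|].
    rewrite IH; f_equal; simpl.
    destruct (classic (P b)); [rewrite !ind_true|rewrite !ind_false]; tauto.
  - rewrite ind_false by assumption.
    assert (0 <= lsum (fun q => ind (P (fst q) /\ P (snd q))) (map (pair a) l))
      by (apply lsum_nonneg; intros; apply ind_bounds).
    lra.
Qed.

(** Induction on the colours: if fewer than [K] elements have the colour [w], discard them and use
    the other colours on the rest. Nonemptiness of [l] rules out an empty list of colours. *)
Lemma filter_pigeonhole {A B : Type} (P : A -> B -> Prop) (K : nat) (W : list B) :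
  forall l : list A, l <> [] -> (K * length W <= length l)%nat ->
  (forall x, In x l -> exists w, In w W /\ P x w) ->
  exists w, In w W /\ (K <= length (filter (fun x => dec (P x w)) l))%nat.
Proof.
  induction W as [|w W IH]; intros l Hne HK Hl.
  - destruct l as [|x l]; [congruence|].
    destruct (Hl x) as (w & [] & _); now left.
  - destruct (le_lt_dec K (length (filter (fun x => dec (P x w)) l))) as [H|H].
    { exists w; split; [now left|assumption]. }
    pose proof (filter_length (fun x => dec (P x w)) l) as HL.
    simpl in HK; rewrite Nat.mul_succ_r in HK.
    set (l' := filter (fun x => negb (dec (P x w))) l) in *.
    destruct (IH l') as (w' & Hw' & Hlen).
    + intros E; rewrite E in HL; simpl in HL; nia.
    + lia.
    + intros x Hx; apply filter_In in Hx as [Hx Hn].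
      destruct (Hl x Hx) as (w' & [<-|Hw'] & HP); [|eauto].
      apply dec_true in HP; rewrite HP in Hn; discriminate.
    + exists w'; split; [now right|].
      eapply Nat.le_trans; [exact Hlen|].
      unfold l'; clear; induction l as [|x l IH]; simpl; [lia|].
      destruct (dec (P x w)), (dec (P x w')) eqn:E; simpl; rewrite ?E; simpl; lia.
Qed.

Lemma list_min_pos {A : Type} (f : A -> R) (l : list A) :
  (forall a, In a l -> 0 < f a) ->
  exists r, 0 < r /\ forall a, In a l -> r <= f a.
Proof.
  induction l as [|a l IH]; intros H; [exists 1; split; [lra|intros ? []]|].
  destruct IH as (r & Hr & Hl); [intros; apply H; now right|].
  assert (0 < f a) by (apply H; now left).
  exists (Rmin r (f a)); split; [now apply Rmin_glb_lt|].
  intros b [<-|Hb]; [apply Rmin_r|].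
  eapply Rle_trans; [apply Rmin_l|auto].
Qed.

Lemma finite_small {B : Type} (Q : B -> R -> Prop) (L : list B) :
  (forall p r r', Q p r -> r' <= r -> Q p r') ->
  (forall p, In p L -> exists r, 0 < r /\ Q p r) ->
  exists r, 0 < r /\ forall p, In p L -> Q p r.
Proof.
  intros Hmono; induction L as [|p L IH]; intros H; [exists 1; split; [lra|intros ? []]|].
  destruct IH as (r & Hr & HL); [intros; apply H; now right|].
  destruct (H p) as (s & Hs & Hp); [now left|].
  exists (Rmin r s); split; [now apply Rmin_glb_lt|].
  intros q [<-|Hq]; eapply Hmono; eauto; [apply Rmin_r|apply Rmin_l].
Qed.

Lemma finite_large {B : Type} (Q : B -> nat -> Prop) (L : list B) :
  (forall p n n', Q p n -> (n <= n')%nat -> Q p n') ->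
  (forall p, In p L -> exists n, Q p n) ->
  exists n, forall p, In p L -> Q p n.
Proof.
  intros Hmono; induction L as [|p L IH]; intros H; [exists 0%nat; intros ? []|].
  destruct IH as (n & HL); [intros; apply H; now right|].
  destruct (H p) as (m & Hp); [now left|].
  exists (max n m); intros q [<-|Hq]; eapply Hmono; eauto; lia.
Qed.

(** * Binary words and the times they select *)

Fixpoint words (n : nat) : list (list bool) :=
  match n with
  | O => [[]]
  | S n => map (cons true) (words n) ++ map (cons false) (words n)
  end.

Lemma length_words n : length (words n) = (2 ^ n)%nat.
Proof. induction n as [|n IH]; simpl; [reflexivity|]. rewrite length_app, !length_map; lia. Qed.

Lemma in_words n w : In w (words n) <-> length w = n.
Proof.
  revert w; induction n as [|n IH]; intros w; simpl.
  { destruct w; simpl; intuition discriminate. }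
  rewrite in_app_iff, !in_map_iff; split.
  - intros [(w' & <- & H)|(w' & <- & H)]; simpl; f_equal; now apply IH.
  - destruct w as [|[|] w]; simpl; intros H; [discriminate| |];
      injection H as H; apply IH in H; [left|right]; eauto.
Qed.

Lemma NoDup_words n : NoDup (words n).
Proof.
  induction n as [|n IH]; simpl; [repeat constructor; tauto|].
  apply NoDup_app.
  - apply Injective_map_NoDup; [intros x y E; now injection E|assumption].
  - apply Injective_map_NoDup; [intros x y E; now injection E|assumption].
  - intros w H1 H2; apply in_map_iff in H1 as (x & <- & _), H2 as (y & E & _); discriminate.
Qed.

(** The entry of [ws] at the position of [a] serves all rows [i] at once. *)
Lemma Forall2_map_column {A B C : Type} (n : nat) (P : nat -> C -> B -> Prop)
  (f : nat -> A -> C) (l : list A) (ws : list B) a :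
  length ws = length l -> (forall i, (i < n)%nat -> Forall2 (P i) (map (f i) l) ws) ->
  In a l -> exists q, forall i, (i < n)%nat -> P i (f i a) q.
Proof.
  revert ws; induction l as [|x l IH]; intros [|q ws] Hlen H Ha;
    [destruct Ha|destruct Ha|discriminate|].
  assert (Hq : forall i, (i < n)%nat -> P i (f i x) q /\ Forall2 (P i) (map (f i) l) ws)
    by (intros i Hi; specialize (H i Hi); simpl in H; inversion H; auto).
  destruct Ha as [->|Ha]; [exists q; apply Hq|].
  apply (IH ws); [now injection Hlen|apply Hq|assumption].
Qed.

(* The [2 ^ length ab] sums obtained by picking from each [(a, b)] the entry [b] or [a]. *)
Fixpoint tm (ab : list (nat * nat)) (s : list bool) : nat :=
  match ab, s with
  | (a, b) :: ab', c :: s' => (if c then b else a) + tm ab' s'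
  | _, _ => 0
  end%nat.

Lemma tm_bounded ab : exists M, forall s, (tm ab s <= M)%nat.
Proof.
  induction ab as [|[a b] ab (M & HM)]; [exists 0%nat; intros; simpl; lia|].
  exists (a + b + M)%nat; intros [|c s]; simpl; [lia|].
  specialize (HM s); destruct c; lia.
Qed.

(** * Compactness and returns *)

Section Dynamics.
Context (X : Type) (d : X -> X -> R) (T : X -> X).
Context (Hmetric : is_metric X d) (Hcompact : is_compact X d).
Context (Hcont : continuous_map X d T).

Local Notation it n := (Nat.iter n T).

Lemma dist_refl x : d x x = 0.
Proof. now apply Hmetric. Qed.

Lemma dist_sym x y : d x y = d y x.
Proof. apply Hmetric. Qed.

Lemma dist_tri x y z : d x z <= d x y + d y z.
Proof. apply Hmetric. Qed.

Lemma dist_quad x y x' y' : d x' y' <= d x y + d x x' + d y y'.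
Proof.
  pose proof (dist_tri x' x y'); pose proof (dist_tri x y y').
  rewrite (dist_sym x' x) in *; lra.
Qed.

Lemma ball_open x r : is_open X d (fun y => d x y < r).
Proof.
  intros y Hy; exists (r - d x y); split; [lra|].
  intros z Hz; pose proof (dist_tri x y z); lra.
Qed.

Lemma dist_bounded : exists D, 0 < D /\ forall x y, d x y <= D.
Proof.
  destruct (classic (inhabited X)) as [[x0]|Hne].
  2: { exists 1; split; [lra|]. intros x; exfalso; apply Hne; now constructor. }
  destruct (Hcompact nat (fun n x => d x0 x < INR n)) as [l Hl].
  - intros n; apply ball_open.
  - intros x; destruct (INR_unbounded (d x0 x)) as [n Hn]; exists n; lra.
  - assert (Hm : forall x, d x0 x <= INR (list_max l)).
    { intros x; destruct (Hl x) as (n & Hn & Hx).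
      enough (INR n <= INR (list_max l)) by lra.
      apply le_INR.
      pose proof (proj1 (list_max_le l (list_max l)) (le_n _)) as HF.
      rewrite Forall_forall in HF; auto. }
    exists (2 * INR (list_max l) + 1); split; [pose proof (pos_INR (list_max l)); lra|].
    intros x y; pose proof (dist_tri x x0 y) as H.
    rewrite (dist_sym x x0) in H.
    pose proof (Hm x); pose proof (Hm y); lra.
Qed.

Lemma uniform_continuity gamma : 0 < gamma ->
  exists delta, 0 < delta /\ forall x y, d x y < delta -> d (T x) (T y) < gamma.
Proof.
  intros Hg.
  (* Indices are centres with a radius of continuity for [gamma / 2]. Covering by balls of half that
     radius leaves room for [y] in the full ball once [x] lies in the half one. *)
  set (I := {q : X * R | 0 < snd q /\
    forall y, d (fst q) y < snd q -> d (T (fst q)) (T y) < gamma / 2}).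
  destruct (Hcompact I (fun i y => d (fst (proj1_sig i)) y < snd (proj1_sig i) / 2))
    as [l Hl].
  - intros i; apply ball_open.
  - intros x; destruct (Hcont x (gamma / 2)) as (r & Hr & Hx); [lra|].
    exists (exist _ (x, r) (conj Hr Hx)); simpl; rewrite dist_refl; lra.
  - destruct (list_min_pos (fun i : I => snd (proj1_sig i) / 2) l) as (r & Hr & Hmin).
    { intros [[x s] [Hs Hx]] _; simpl in *; lra. }
    exists r; split; [assumption|].
    intros x y Hxy; destruct (Hl x) as (i & Hi & Hx).
    specialize (Hmin i Hi); destruct i as [[z s] [Hs Hz]]; simpl in *.
    assert (d (T z) (T x) < gamma / 2) by (apply Hz; lra).
    assert (d (T z) (T y) < gamma / 2)
      by (apply Hz; pose proof (dist_tri z x y); lra).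
    pose proof (dist_tri (T x) (T z) (T y)).
    rewrite (dist_sym (T x) (T z)) in *; lra.
Qed.

Lemma uniform_continuity_iter (M : nat) gamma : 0 < gamma ->
  exists delta, 0 < delta /\ forall x y, d x y < delta ->
    forall t, (t <= M)%nat -> d (it t x) (it t y) < gamma.
Proof.
  revert gamma; induction M as [|M IH]; intros gamma Hg.
  - exists gamma; split; [assumption|]. intros x y H t Ht.
    now replace t with 0%nat by lia.
  - destruct (uniform_continuity gamma Hg) as (r & Hr & HT).
    destruct (IH (Rmin gamma r)) as (s & Hs & HM); [now apply Rmin_glb_lt|].
    exists s; split; [assumption|].
    intros x y Hxy t Ht.
    destruct (Nat.eq_dec t (S M)) as [->|Hne].
    + simpl; apply HT.
      eapply Rlt_le_trans; [apply (HM x y Hxy M)|apply Rmin_r]; lia.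
    + eapply Rlt_le_trans; [apply (HM x y Hxy t)|apply Rmin_l]; lia.
Qed.

(** By minimality every point of the orbit closure enters the [r]-ball about [y], and compactness
    leaves finitely many entrance times. *)
Lemma minimal_syndetic y r : minimal_point X d T y -> 0 < r ->
  exists L : list nat, forall n, exists k, In k L /\ d y (it (k + n) y) < r.
Proof.
  intros Hmin Hr.
  set (Y := in_closure X d (orbit X T y)).
  (* The index [None], the open complement of the orbit closure, completes the cover to all of
     [X]. *)
  set (U := fun (o : option nat) z =>
    match o with None => ~ Y z | Some k => d y (it k z) < r end).
  destruct (Hcompact (option nat) U) as [l Hl].
  - intros [k|] z Hz; simpl in *.
    + destruct (uniform_continuity_iter k (r - d y (it k z))) as (s & Hs & Hk); [lra|].
      exists s; split; [assumption|]; intros z' Hz'.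
      specialize (Hk z z' Hz' k (le_n _)).
      pose proof (dist_tri y (it k z) (it k z')); lra.
    + apply not_all_ex_not in Hz as [e He].
      apply imply_to_and in He as [He Hz].
      exists (e / 2); split; [lra|]; intros z' Hz' HY.
      destruct (HY (e / 2)) as (s & Hs & Hd); [lra|].
      apply Hz; exists s; split; [assumption|].
      pose proof (dist_tri z z' s); lra.
  - intros z; destruct (classic (Y z)) as [HY|HY]; [|now exists None].
    assert (Hy : Y y).
    { intros e He; exists y; rewrite dist_refl; split; [now exists 0%nat|assumption]. }
    destruct (Hmin z HY y Hy r Hr) as (s & (k & ->) & Hk).
    now exists (Some k).
  - exists (flat_map (fun o => match o with Some k => [k] | None => [] end) l).
    intros n; destruct (Hl (it n y)) as ([k|] & Hk & HU); simpl in HU.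
    + exists k; rewrite Nat.iter_add; split; [|assumption].
      apply in_flat_map; exists (Some k); simpl; auto.
    + exfalso; apply HU; intros e He; exists (it n y).
      rewrite dist_refl; split; [now exists n|assumption].
Qed.

Context (Hdense : minimal_points_dense X d T).

(** A minimal [y] near [x] returns with bounded gaps, so at every time [n] one of finitely many
    iterates of [y] is brought back near [x]. *)
Lemma finite_return x r : 0 < r ->
  exists W : list X, forall n, exists w, In w W /\ d x (it n w) < r.
Proof.
  intros Hr; destruct (Hdense x (r / 2)) as (y & Hmin & Hxy); [lra|].
  destruct (minimal_syndetic y (r / 2) Hmin) as [L HL]; [lra|].
  exists (map (fun k => it k y) L); intros n.
  destruct (HL n) as (k & Hk & Hd).
  exists (it k y); split; [now apply (in_map (fun k => it k y))|].
  rewrite <- Nat.iter_add, Nat.add_comm.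
  pose proof (dist_tri x y (it (k + n) y)); lra.
Qed.

(** Each coordinate has its own finite list of starting points; the product of these lists serves
    the whole tuple. *)
Lemma finite_return_pairs (ws : list (X * X)) r : 0 < r ->
  exists W : list (list (X * X)), forall n, exists ws', In ws' W /\
    Forall2 (fun q q' => d (fst q) (it n (fst q')) < r /\ d (snd q) (it n (snd q')) < r)
      ws ws'.
Proof.
  intros Hr; induction ws as [|[x y] ws (W & HW)].
  - exists [[]]; intros n; exists []; simpl; auto.
  - destruct (finite_return x r Hr) as [Wx Hx], (finite_return y r Hr) as [Wy Hy].
    exists (map (fun q => fst q :: snd q) (list_prod (list_prod Wx Wy) W)).
    intros n; destruct (Hx n) as (x' & Ix & Dx), (Hy n) as (y' & Iy & Dy),
      (HW n) as (ws' & Iw & Dw).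
    exists ((x', y') :: ws'); split; [|constructor; auto].
    apply in_map_iff; exists ((x', y'), ws'); split; [reflexivity|].
    now repeat apply in_prod.
Qed.

(** * Shattering *)

(** A pair counts as far apart above [alpha] and as close below [beta]. *)
Context (alpha beta : R).

(* [n + tm ab s] separates [u] and [v] for every word [s]. *)
Fixpoint all_sep (u v : X) (ab : list (nat * nat)) (n : nat) : Prop :=
  match ab with
  | [] => alpha < d (it n u) (it n v)
  | (a, b) :: ab' => all_sep u v ab' (n + a)%nat /\ all_sep u v ab' (n + b)%nat
  end.

Lemma all_sep_tm u v ab : forall s n, length s = length ab -> all_sep u v ab n ->
  alpha < d (it (n + tm ab s) u) (it (n + tm ab s) v).
Proof.
  induction ab as [|[a b] ab IH]; intros [|c s] n Hs H; try discriminate Hs.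
  - simpl tm; now rewrite Nat.add_0_r.
  - simpl tm; rewrite Nat.add_assoc; apply IH; [now injection Hs|].
    destruct H, c; assumption.
Qed.

(** A form of upper density at least [c], for arbitrarily close pairs: the count reaches [c * N] for
    arbitrarily large [N]. *)
Definition often ab c : Prop := forall delta, 0 < delta -> exists u v, d u v < delta /\
  forall N0, exists N, (N0 <= N)%nat /\
    c * INR N <= rsum (fun i => ind (all_sep u v ab i)) N.

(* Among many translates of a set of upper density at least [c], two meet in positive upper
   density. *)
Lemma often_pairs {A : Type} (f : A -> nat) ab c (l : list A) :
  0 < c -> often ab c -> 2 <= INR (length l) * (c / 2) ->
  exists p, In p (pairs l) /\ exists c', 0 < c' /\ often ((f (snd p), f (fst p)) :: ab) c'.
Proof.
  intros Hc Hoften HK; set (K := INR (length l)) in *.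
  assert (HK0 : 0 < K) by (assert (0 <= K) by apply pos_INR; nra).
  (* There are at most [K * K] pairs, so intersections of density at most [c'] total at most
     [N / 2]. The translates total at least [2 * N], against an upper bound of [N + N / 2]. *)
  set (c' := / (2 * (K * K))).
  assert (Hc' : 0 < c') by (apply Rinv_0_lt_compat; nra).
  apply NNPP; intros Hno.
  (* If every pair of translates fails, one [delta] witnesses all the failures, and a single
     [(u, v)] can be tested against all of them. *)
  destruct (finite_small (fun p delta => forall u v, d u v < delta ->
    exists N0, forall N, (N0 <= N)%nat ->
      rsum (fun i => ind (all_sep u v ((f (snd p), f (fst p)) :: ab) i)) N <= c' * INR N)
    (pairs l)) as (delta & Hd & Hp).
  { intros p r r' H Hr u v Huv; apply H; lra. }
  { intros p Hp; apply NNPP; intros Hp'; apply Hno.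
    exists p; split; [assumption|]; exists c'; split; [assumption|].
    intros delta Hd; apply NNPP; intros Huv; apply Hp'.
    exists delta; split; [assumption|]; intros u v Hlt.
    apply NNPP; intros HN; apply Huv; exists u, v; split; [assumption|].
    intros N0; apply NNPP; intros HN0; apply HN; exists N0; intros N HN1.
    apply Rnot_lt_le; intros Hlt'; apply HN0; exists N; split; [assumption|lra]. }
  destruct (Hoften delta Hd) as (u & v & Huv & HN).
  destruct (finite_large (fun p N0 => forall N, (N0 <= N)%nat ->
      rsum (fun i => ind (all_sep u v ((f (snd p), f (fst p)) :: ab) i)) N <= c' * INR N)
    (pairs l)) as (N1 & H1).
  { intros p n n' H Hn N HN'; apply H; lia. }
  { intros p Hin; now apply Hp. }
  (* From [N2] on, the shift by [f a] costs at most half of the count [c * N]. *)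
  destruct (finite_large (fun a N0 => forall N, (N0 <= N)%nat ->
      INR (f a) <= c / 2 * INR N) l) as (N2 & H2).
  { intros p n n' H Hn N HN'; apply H; lia. }
  { intros a _; destruct (INR_unbounded (INR (f a) * (2 / c))) as (N0 & HN0).
    exists N0; intros N HN'.
    apply le_INR in HN'.
    replace (INR (f a)) with (c / 2 * (INR (f a) * (2 / c))) by (field; lra).
    apply Rmult_le_compat_l; lra. }
  destruct (HN (max 1 (max N1 N2))) as (N & HNN & Hcount).
  assert (HN1 : 1 <= INR N) by (apply (le_INR 1); lia).
  set (P := fun i a => all_sep u v ab (i + f a)).
  assert (Hpt : rsum (fun i => lsum (fun a => ind (P i a)) l) N <=
    rsum (fun i => 1 + lsum (fun q => ind (P i (fst q) /\ P i (snd q))) (pairs l)) N)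
    by (apply rsum_le; intros i; apply lsum_ind_le_pairs).
  rewrite rsum_plus, rsum_const, !rsum_lsum in Hpt.
  assert (Hlow : INR (length l) * (c / 2 * INR N) <=
    lsum (fun a => rsum (fun i => ind (P i a)) N) l).
  { apply lsum_ge_const; intros a Ha.
    pose proof (rsum_shift_ge (fun i => ind (all_sep u v ab i)) (f a) N
      (fun i => ind_bounds _)) as Hs.
    specialize (H2 a Ha N ltac:(lia)); unfold P; lra. }
  assert (Hup : lsum (fun q => rsum (fun i => ind (P i (fst q) /\ P i (snd q))) N) (pairs l)
    <= INR (length (pairs l)) * (c' * INR N)).
  { apply lsum_le_const; intros q Hq.
    eapply Rle_trans; [|apply (H1 q Hq N); lia].
    apply rsum_le; intros i; simpl; unfold P.
    destruct (classic (all_sep u v ab (i + f (fst q))%nat /\ all_sep u v ab (i + f (snd q))%nat)).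
    - rewrite !ind_true; tauto || lra.
    - rewrite ind_false by assumption; apply ind_bounds. }
  assert (Hlen : INR (length (pairs l)) <= K * K)
    by (unfold K; rewrite <- mult_INR; apply le_INR, length_pairs).
  assert (Hfin : INR (length (pairs l)) * (c' * INR N) <= / 2 * INR N).
  { replace (/ 2 * INR N) with (K * K * (c' * INR N)) by (unfold c'; field; lra).
    apply Rmult_le_compat_r; [|assumption]; apply Rmult_le_pos; lra. }
  fold K in Hlow.
  assert (2 * INR N <= K * (c / 2) * INR N) by (apply Rmult_le_compat_r; lra).
  lra.
Qed.

(* The [i]-th letter of [s] tells whether the [i]-th pair is far apart or close at time
   [tm ab s]; the slack [theta] absorbs the perturbations made at each step. *)
Definition pat theta t (b : bool) (q : X * X) : Prop :=
  if b then alpha - theta < d (it t (fst q)) (it t (snd q))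
  else d (it t (fst q)) (it t (snd q)) < beta + theta.

Definition shattered theta ab ws : Prop :=
  forall s, length s = length ab -> Forall2 (pat theta (tm ab s)) s ws.

(* The tuples in [W] play the role of colours of the time axis. *)
Lemma shattered_return theta gamma ab ws : 0 < gamma -> shattered theta ab ws ->
  exists W, forall n, exists ws', In ws' W /\
    forall s, length s = length ab -> Forall2 (pat (theta + gamma) (n + tm ab s)) s ws'.
Proof.
  intros Hg Hsh; destruct (tm_bounded ab) as [M HM].
  (* Both points of a pair are perturbed, hence [gamma / 2] for each. Since [M] bounds every
     [tm ab s], one return at time [n] serves all words. *)
  destruct (uniform_continuity_iter M (gamma / 2)) as (r & Hr & Huc); [lra|].
  destruct (finite_return_pairs ws r Hr) as [W HW]; exists W; intros n.
  destruct (HW n) as (ws' & Hin & Hws); exists ws'; split; [assumption|].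
  intros s Hs; specialize (Hsh s Hs).
  specialize (HM s); revert HM; generalize (tm ab s) Hsh.
  clear - Hws Huc Hmetric; intros t Hsh Ht.
  revert s Hsh; induction Hws as [|[x y] [x' y'] ws ws' [Hx Hy] _ IH]; intros s Hsh;
    inversion Hsh as [|c q s' w' Hc Hs' E1 E2]; subst; constructor; [|now apply IH].
  simpl in *; apply Huc with (t := t) in Hx, Hy; try assumption.
  rewrite <- !Nat.iter_add, (Nat.add_comm t n) in *.
  unfold pat in *; simpl in *.
  destruct c.
  - pose proof (dist_quad (it (n + t) x') (it (n + t) y') (it t x) (it t y)) as H.
    rewrite (dist_sym (it (n + t) x') (it t x)), (dist_sym (it (n + t) y') (it t y)) in H; lra.
  - pose proof (dist_quad (it t x) (it t y) (it (n + t) x') (it (n + t) y')); lra.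
Qed.

(** Each new pair is taken so close that it stays within [beta] at all times its predecessors use;
    [often] then supplies a time of its own. New entries go to the front, so the first component of
    a member of [pairs l] is the one chosen later. *)
Lemma long_chain ab c K : 0 < beta -> 0 < c -> often ab c ->
  exists l : list (nat * (X * X)), length l = K /\
    (forall e, In e l -> all_sep (fst (snd e)) (snd (snd e)) ab (fst e)) /\
    (forall e e', In (e, e') (pairs l) -> forall s,
      d (it (fst e' + tm ab s) (fst (snd e))) (it (fst e' + tm ab s) (snd (snd e))) < beta).
Proof.
  intros Hb Hc Hoften; destruct (tm_bounded ab) as [M HM].
  induction K as [|K (l & Hl & Hsep & Hclose)].
  { exists []; simpl; repeat split; intros; tauto. }
  destruct (uniform_continuity_iter (list_max (map fst l) + M) beta Hb) as (r & Hr & Huc).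
  destruct (Hoften r Hr) as (u & v & Huv & HN).
  destruct (HN 1%nat) as (N & HN1 & Hcount).
  destruct (rsum_ind_pos (all_sep u v ab) N) as [n Hn].
  { apply le_INR in HN1; simpl in HN1; nra. }
  exists ((n, (u, v)) :: l); repeat split; [simpl; lia| |].
  - intros e [<-|He]; auto.
  - intros e e' He s; simpl in He; apply in_app_iff in He as [He|He]; [|now apply Hclose].
    apply in_map_iff in He as (e2 & E & He2); injection E as <- <-; simpl.
    apply Huc; [assumption|].
    assert (fst e2 <= list_max (map fst l))%nat.
    { pose proof (proj1 (list_max_le _ _) (le_n (list_max (map fst l)))) as HF.
      rewrite Forall_forall in HF; apply HF, in_map, He2. }
    specialize (HM s); lia.
Qed.

(* Take two members [e'], [e] of a long chain, [e] the later one, whose times have the same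
   colour [ws']. At [fst e'] and at [fst e] the pairs of [ws'] show all their patterns, while
   the new pair [snd e] is close at the former times and far apart at the latter. *)
Lemma exists_shattered c0 : 0 < beta -> 0 < c0 -> often [] c0 ->
  forall m theta, 0 < theta -> exists ab ws c,
    length ab = m /\ 0 < c /\ often ab c /\ shattered theta ab ws.
Proof.
  intros Hb Hc0 H0 m; induction m as [|m IH]; intros theta Ht.
  { exists [], [], c0; repeat split; try assumption.
    intros [|] Hs; [constructor|discriminate]. }
  (* Half of the slack is left to the earlier pairs, half to the perturbation by the return. *)
  destruct (IH (theta / 2)) as (ab & ws & c & Hab & Hc & Hoften & Hsh); [lra|].
  destruct (shattered_return (theta / 2) (theta / 2) ab ws) as [W HW]; [lra|assumption|].
  replace (theta / 2 + theta / 2) with theta in HW by field.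
  destruct (INR_unbounded (2 * (2 / c))) as [K HK].
  assert (HKc : 2 <= INR K * (c / 2)).
  { replace 2 with (2 * (2 / c) * (c / 2)) at 1 by (field; lra).
    apply Rmult_le_compat_r; lra. }
  (* Enough entries for [K] of one colour, as [often_pairs] will require; the extra one keeps the
     chain nonempty. *)
  destruct (long_chain ab c (1 + K * length W) Hb Hc Hoften) as (l & Hl & Hsep & Hclose).
  set (good := fun (e : nat * (X * X)) ws' => forall s, length s = length ab ->
    Forall2 (pat theta (fst e + tm ab s)) s ws').
  destruct (filter_pigeonhole good K W l) as (ws' & _ & Hlen).
  { intros ->; discriminate. }
  { lia. }
  { intros e _; apply (HW (fst e)). }
  set (l' := filter (fun e => dec (good e ws')) l) in *.
  destruct (often_pairs fst ab c l' Hc Hoften) as ([e e'] & He & c' & Hc' & Hoften').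
  { eapply Rle_trans; [exact HKc|].
    apply Rmult_le_compat_r; [lra|now apply le_INR]. }
  simpl in Hoften'.
  (* The letter [true] picks the second time, so [fst e], where [snd e] is far apart, comes
     second. *)
  exists ((fst e', fst e) :: ab), (snd e :: ws'), c'.
  repeat split; try assumption; [simpl; lia|].
  assert (Hin := pairs_In _ _ _ He).
  apply pairs_filter in He.
  destruct Hin as [Hin Hin'].
  apply filter_In in Hin as [Hin Hg], Hin' as [Hin' Hg'].
  apply (proj1 (dec_true _)) in Hg, Hg'.
  intros [|b s] Hs; [discriminate|]; injection Hs as Hs; simpl tm.
  constructor; [|destruct b; [apply Hg|apply Hg']; assumption].
  destruct b; unfold pat.
  - pose proof (all_sep_tm _ _ ab s _ Hs (Hsep e Hin)); lra.
  - pose proof (Hclose e e' He s); lra.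
Qed.

(** In the product system on pairs, [A] is an independence set for the far pairs and the close
    pairs. *)
Definition independent (a b : R) (A : list nat) : Prop :=
  forall sigma : nat -> bool, exists u v, forall t, In t A ->
    if sigma t then a < d (it t u) (it t v) else d (it t u) (it t v) < b.

(* Duality: [2 ^ n] pairs shattered by times give [n] times shattered by pairs. The pairs
   are labelled by the words of length [n], and the [i]-th time separates exactly the
   pairs whose label has [i]-th letter [true]. *)
Lemma shattered_independent n theta ab ws :
  length ab = (2 ^ n)%nat -> shattered theta ab ws -> beta + theta <= alpha - theta ->
  exists A, length A = n /\ NoDup A /\ independent (alpha - theta) (beta + theta) A.
Proof.
  intros Hab Hsh Hle.
  set (letter := fun i (w : list bool) => nth i w false).
  set (tau := fun i => tm ab (map (letter i) (words n))).
  assert (Hcol : forall i, Forall2 (pat theta (tau i)) (map (letter i) (words n)) ws)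
    by (intros i; apply Hsh; now rewrite length_map, length_words).
  assert (Hlen : length ws = length (words n))
    by (rewrite <- (Forall2_length (Hcol 0%nat)); apply length_map).
  assert (Hpat : forall sigma : nat -> bool, exists q, forall i, (i < n)%nat ->
    pat theta (tau i) (sigma i) q).
  { intros sigma.
    destruct (Forall2_map_column n (fun i => pat theta (tau i)) letter (words n) ws
      (map sigma (seq 0 n)) Hlen (fun i _ => Hcol i)) as [q Hq].
    { apply in_words; now rewrite length_map, length_seq. }
    exists q; intros i Hi; specialize (Hq i Hi); unfold letter in Hq.
    (* The default [false] is traded for [sigma 0], the form that [map_nth] asks for. *)
    rewrite (nth_indep _ false (sigma 0%nat)), map_nth, seq_nth in Hq; try assumption.
    now rewrite length_map, length_seq. }
  exists (map tau (seq 0 n)); repeat split.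
  - now rewrite length_map, length_seq.
  - apply NoDup_map_NoDup_ForallPairs; [|apply seq_NoDup].
    intros i j Hi Hj E; apply in_seq in Hi, Hj.
    destruct (Nat.eq_dec i j) as [|Hne]; [assumption|exfalso].
    (* With the pattern true at [i] only, equal times would make one pair both far and close. *)
    destruct (Hpat (Nat.eqb i)) as [q Hq].
    pose proof (Hq i ltac:(lia)) as H1; pose proof (Hq j ltac:(lia)) as H2.
    rewrite Nat.eqb_refl in H1; apply Nat.eqb_neq in Hne; rewrite Hne, <- E in H2.
    unfold pat in *; lra.
  - intros sigma; destruct (Hpat (fun i => sigma (tau i))) as [[u v] Hq].
    exists u, v; intros t Ht; apply in_map_iff in Ht as (i & <- & Hi).
    apply in_seq in Hi; apply (Hq i); lia.
Qed.

End Dynamics.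

(** * Sequence entropy *)

Lemma sorted_filter_seq (f : nat -> bool) p n : StronglySorted lt (filter f (seq p n)).
Proof.
  revert p; induction n as [|n IH]; intros p; simpl; [constructor|].
  destruct (f p); [|apply IH]; constructor; [apply IH|].
  apply Forall_forall; intros x Hx; apply filter_In in Hx as [Hx _].
  apply in_seq in Hx; lia.
Qed.

Lemma sorted_app (l l' : list nat) : StronglySorted lt l -> StronglySorted lt l' ->
  (forall x y, In x l -> In y l' -> (x < y)%nat) -> StronglySorted lt (l ++ l').
Proof.
  intros Hl Hl' H; induction Hl as [|x l Hl IH HF]; simpl; [assumption|].
  constructor.
  - apply IH; intros; apply H; simpl; auto.
  - apply Forall_app; split; [assumption|].
    apply Forall_forall; intros y Hy; apply H; simpl; auto.
Qed.

Lemma sorted_nth (l : list nat) i : StronglySorted lt l -> (S i < length l)%nat ->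
  (nth i l 0 < nth (S i) l 0)%nat.
Proof.
  intros Hl; revert i; induction Hl as [|x l Hl IH HF]; intros i Hi; simpl in Hi; [lia|].
  destruct i as [|i]; [|apply IH; lia].
  rewrite Forall_forall in HF; simpl; apply HF, nth_In; lia.
Qed.

Lemma sorted_NoDup (l : list nat) : StronglySorted lt l -> NoDup l.
Proof.
  induction 1 as [|x l Hl IH HF]; constructor; [|assumption].
  intros Hx; rewrite Forall_forall in HF; specialize (HF x Hx); lia.
Qed.

(* Only [p + 1] elements are lost in dropping those up to [p]. *)
Lemma sorted_part_above (A0 : list nat) n p : NoDup A0 -> length A0 = (n + S p)%nat ->
  exists A, incl A A0 /\ StronglySorted lt A /\ (n <= length A)%nat /\
    forall x, In x A -> (p < x)%nat.
Proof.
  intros Hnd Hlen.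
  exists (filter (fun x => dec (In x A0)) (seq (S p) (list_max A0))).
  repeat split.
  - intros x Hx; apply filter_In in Hx as [_ Hx]; now apply (proj1 (dec_true _)) in Hx.
  - apply sorted_filter_seq.
  - pose proof (filter_length (fun x => Nat.ltb p x) A0) as HL.
    assert (H1 : (length (filter (fun x => negb (Nat.ltb p x)) A0) <= length (seq 0 (S p)))%nat).
    { apply NoDup_incl_length; [now apply NoDup_filter|].
      intros x Hx; apply filter_In in Hx as [_ Hx]; apply in_seq.
      destruct (Nat.ltb_spec p x); [discriminate|lia]. }
    assert (H2 : (length (filter (fun x => Nat.ltb p x) A0) <=
      length (filter (fun x => dec (In x A0)) (seq (S p) (list_max A0))))%nat).
    { apply NoDup_incl_length; [now apply NoDup_filter|].
      intros x Hx; apply filter_In in Hx as [Hx Hp]; apply Nat.ltb_lt in Hp.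
      apply filter_In; split; [|now apply dec_true].
      apply in_seq.
      pose proof (proj1 (list_max_le _ _) (le_n (list_max A0))) as HF.
      rewrite Forall_forall in HF; specialize (HF x Hx); lia. }
    rewrite length_seq in H1; lia.
  - intros x Hx; apply filter_In in Hx as [Hx _]; apply in_seq in Hx; lia.
Qed.

(* Concatenating longer and longer blocks: infinitely often the last block is at least half
   of an initial segment of the sequence. *)
Lemma exists_sequence_of_blocks (B : list nat -> Prop) :
  (forall n p, exists A, B A /\ StronglySorted lt A /\ (n <= length A)%nat /\
    forall x, In x A -> (p < x)%nat) ->
  exists t : nat -> nat, (forall i, (t i < t (S i))%nat) /\
    forall N, exists n A, (N <= n)%nat /\ B A /\ NoDup A /\ (0 < n <= 2 * length A)%nat /\
      forall x, In x A -> exists i, (i < n)%nat /\ t i = x.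
Proof.
  intros HB.
  destruct (choice (fun l A => B A /\ StronglySorted lt A /\
    (S (length l) <= length A)%nat /\ forall x, In x A -> (list_max l < x)%nat)
    (fun l => HB (S (length l)) (list_max l))) as [blk Hblk].
  set (L := fix L k := match k with O => [] | S k => L k ++ blk (L k) end).
  assert (Hlen : forall k, (k <= length (L k))%nat).
  { induction k as [|k IH]; simpl; [lia|]. rewrite length_app.
    destruct (Hblk (L k)) as (_ & _ & H & _); lia. }
  assert (Hsort : forall k, StronglySorted lt (L k)).
  { induction k as [|k IH]; simpl; [constructor|].
    destruct (Hblk (L k)) as (_ & H1 & _ & H2).
    apply sorted_app; [assumption|assumption|].
    intros x y Hx Hy; specialize (H2 y Hy).
    pose proof (proj1 (list_max_le _ _) (le_n (list_max (L k)))) as HF.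
    rewrite Forall_forall in HF; specialize (HF x Hx); lia. }
  assert (Hpre : forall k j i, (i < length (L k))%nat ->
    nth i (L (j + k)%nat) 0%nat = nth i (L k) 0%nat).
  { intros k; induction j as [|j IH]; intros i Hi; [reflexivity|].
    assert (Hle : (length (L k) <= length (L (j + k)%nat))%nat).
    { clear; induction j as [|j IH]; simpl; [lia|]. rewrite length_app; lia. }
    simpl; rewrite app_nth1 by lia; now apply IH. }
  assert (Ht : forall k i, (i < length (L k))%nat -> nth i (L (S i)) 0%nat = nth i (L k) 0%nat).
  { intros k i Hi; destruct (le_lt_dec k (S i)) as [H|H].
    - replace (S i) with ((S i - k) + k)%nat at 1 by lia; now apply Hpre.
    - replace k with ((k - S i) + S i)%nat by lia; symmetry; apply Hpre.
      specialize (Hlen (S i)); lia. }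
  (* Stage [S i] has more than [i] entries, and later stages only extend it, so entry [i] is final
     there. *)
  exists (fun i => nth i (L (S i)) 0%nat); split.
  - intros i; pose proof (Hlen (S (S i))) as Hi.
    rewrite (Ht (S (S i)) i) by lia.
    apply sorted_nth; [apply Hsort|lia].
  - intros N; exists (length (L (S N))), (blk (L N)).
    destruct (Hblk (L N)) as (HBA & HS & Hl & _).
    pose proof (Hlen (S N)) as HN.
    split; [lia|]; split; [assumption|]; split; [now apply sorted_NoDup|]; split.
    + split; [lia|]. simpl; rewrite length_app; lia.
    + intros x Hx.
      destruct (In_nth (L (S N)) x 0%nat) as (i & Hi & E); [simpl; apply in_or_app; now right|].
      exists i; split; [assumption|]; rewrite <- E; now apply Ht.
Qed.

Lemma least_nat (P : nat -> Prop) : (exists n, P n) ->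
  exists n, P n /\ forall m, P m -> (n <= m)%nat.
Proof.
  intros [n Hn]; revert Hn; induction n as [n IH] using lt_wf_ind; intros Hn.
  destruct (classic (exists m, (m < n)%nat /\ P m)) as [(m & Hm & HP)|Hno]; [eauto|].
  exists n; split; [assumption|]; intros m Hm.
  destruct (le_lt_dec n m); [assumption|exfalso; eauto].
Qed.

(** Converts a word into a function of time, the form in which [independent] takes patterns. *)
Fixpoint letter_at (A : list nat) (w : list bool) (t : nat) : bool :=
  match A, w with
  | x :: A', b :: w' => if Nat.eqb x t then b else letter_at A' w' t
  | _, _ => false
  end.

Lemma letter_at_inj A : NoDup A -> forall w w', length w = length A -> length w' = length A ->
  (forall t, In t A -> letter_at A w t = letter_at A w' t) -> w = w'.
Proof.
  induction 1 as [|x A Hx HA IH]; intros [|b w] [|b' w'] Hw Hw' H;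
    try discriminate; [reflexivity|].
  injection Hw as Hw; injection Hw' as Hw'; f_equal.
  - specialize (H x (or_introl eq_refl)); simpl in H; now rewrite Nat.eqb_refl in H.
  - apply IH; [assumption|assumption|]; intros t Ht.
    specialize (H t (or_intror Ht)); simpl in H.
    destruct (Nat.eqb_spec x t); [congruence|assumption].
Qed.

(** * Joins along independent sets of times *)

Section Entropy.
Context (X : Type) (d : X -> X -> R) (T : X -> X).
Context (Hmetric : is_metric X d) (Hcompact : is_compact X d).

Local Notation it n := (Nat.iter n T).

(** The entropy condition quantifies over sequences of minimal cardinalities, so one must exist. A
    finite subcover of the join is refined one time at a time. *)
Lemma exists_is_N t U n : open_cover X d U -> exists k, is_N X (join_elem X T t U n) k.
Proof.
  intros [_ HU]; apply least_nat.
  enough (exists l, Forall (join_elem X T t U n) l /\ forall x, exists V, In V l /\ V x)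
    as (l & Hl & Hcov) by (exists (length l), l; auto).
  induction n as [|n (l & Hl & Hcov)].
  - exists [fun _ => True]; split; [|intros x; exists (fun _ => True); simpl; auto].
    constructor; [|constructor]; exists (fun _ => 0%nat).
    split; [lia|]; intros x; split; [lia|trivial].
  - exists (map (fun q x => fst q x /\ nth (snd q) U (fun _ => False) (it (t n) x))
      (list_prod l (seq 0 (length U)))); split.
    + apply Forall_forall; intros V HV.
      apply in_map_iff in HV as ([W j] & <- & Hq); apply in_prod_iff in Hq as [HW Hj].
      apply in_seq in Hj; rewrite Forall_forall in Hl; destruct (Hl W HW) as (f & Hf & HfW).
      exists (fun i => if Nat.eqb i n then j else f i); split.
      { intros i Hi; destruct (Nat.eqb_spec i n); [lia|apply Hf; lia]. }
      intros x; simpl; rewrite HfW; split.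
      * intros [H1 H2] i Hi; destruct (Nat.eqb_spec i n); [subst; assumption|apply H1; lia].
      * intros H; split; [|specialize (H n); rewrite Nat.eqb_refl in H; apply H; lia].
        intros i Hi; specialize (H i); destruct (Nat.eqb_spec i n); [lia|apply H; lia].
    + intros x; destruct (Hcov x) as (W & HW & Hx), (HU (it (t n) x)) as (V & HV & HVx).
      destruct (In_nth U V (fun _ => False) HV) as (j & Hj & E).
      eexists; split.
      * apply in_map, in_prod; [exact HW|apply in_seq; split; [|exact Hj]; lia].
      * simpl; rewrite E; auto.
Qed.

(* Two pairs with different itineraries cannot lie in the same [V x V'] with [V], [V'] in the
   join, since the cover is finer than the gap [a - b]. *)
Lemma independent_card_le a b A t U n l :
  independent X d T a b A -> NoDup A ->
  (forall x, In x A -> exists i, (i < n)%nat /\ t i = x) ->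
  (forall V x y, In V U -> V x -> V y -> d x y < (a - b) / 2) ->
  Forall (join_elem X T t U n) l -> (forall x, exists V, In V l /\ V x) ->
  (2 ^ length A <= length l * length l)%nat.
Proof.
  intros Hind Hnd HA HU Hl Hcov.
  assert (Hdiam : forall V x y s, In V l -> V x -> V y -> In s A ->
    d (it s x) (it s y) < (a - b) / 2).
  { intros V x y s HV Hx Hy Hs; rewrite Forall_forall in Hl.
    destruct (Hl V HV) as (f & Hf & HfV); destruct (HA s Hs) as (i & Hi & <-).
    rewrite HfV in Hx, Hy; apply HU with (V := nth (f i) U (fun _ => False)); auto.
    apply nth_In; auto. }
  assert (Hcode : forall w, exists q, In q (list_prod l l) /\ exists u v,
    fst q u /\ snd q v /\ forall s, In s A ->
    if letter_at A w s then a < d (it s u) (it s v) else d (it s u) (it s v) < b).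
  { intros w; destruct (Hind (letter_at A w)) as (u & v & Huv).
    destruct (Hcov u) as (V & HV & Hu), (Hcov v) as (V' & HV' & Hv).
    exists (V, V'); split; [now apply in_prod|]; eauto 6. }
  apply choice in Hcode as [code Hcode].
  rewrite <- length_words, <- (length_map code), <- (length_prod l l).
  apply NoDup_incl_length.
  2: { intros q Hq; apply in_map_iff in Hq as (w & <- & _); apply Hcode. }
  apply NoDup_map_NoDup_ForallPairs; [|apply NoDup_words].
  intros w w' Hw Hw' E; apply in_words in Hw, Hw'.
  apply (letter_at_inj A Hnd); [assumption|assumption|]; intros s Hs.
  destruct (Hcode w) as (Hq & u & v & Hu & Hv & Huv).
  destruct (Hcode w') as (_ & u' & v' & Hu' & Hv' & Huv').
  rewrite <- E in Hu', Hv'; destruct (code w) as [V V'].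
  apply in_prod_iff in Hq as [HV HV']; simpl in *.
  pose proof (Hdiam V u u' s HV Hu Hu' Hs); pose proof (Hdiam V u' u s HV Hu' Hu Hs).
  pose proof (Hdiam V' v v' s HV' Hv Hv' Hs); pose proof (Hdiam V' v' v s HV' Hv' Hv Hs).
  pose proof (dist_quad X d Hmetric (it s u) (it s v) (it s u') (it s v')).
  pose proof (dist_quad X d Hmetric (it s u') (it s v') (it s u) (it s v)).
  specialize (Huv s Hs); specialize (Huv' s Hs).
  destruct (letter_at A w s), (letter_at A w' s); try reflexivity; exfalso; lra.
Qed.

Lemma null_independent_bounded a b : null_system X d T -> b < a ->
  ~ (forall n, exists A, length A = n /\ NoDup A /\ independent X d T a b A).
Proof.
  intros Hnull Hab Hind.
  destruct (exists_sequence_of_blocks (independent X d T a b)) as (t & Ht & Hblocks).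
  { intros n p; destruct (Hind (n + S p)%nat) as (A0 & Hlen & Hnd & HA0).
    destruct (sorted_part_above A0 n p Hnd Hlen) as (A & Hincl & HA).
    exists A; split; [|exact HA].
    intros sigma; destruct (HA0 sigma) as (u & v & Huv); exists u, v.
    intros s Hs; apply Huv, Hincl, Hs. }
  (* Two points of such a ball are less than [(a - b) / 2] apart, as [independent_card_le] asks. *)
  destruct (Hcompact X (fun x y => d x y < (a - b) / 4)) as [l Hl].
  { intros x; now apply ball_open. }
  { intros x; exists x; rewrite dist_refl by assumption; lra. }
  set (U := map (fun x y => d x y < (a - b) / 4) l).
  assert (HU : open_cover X d U).
  { split.
    - intros V HV; apply in_map_iff in HV as (x & <- & _); now apply ball_open.
    - intros x; destruct (Hl x) as (y & Hy & Hxy).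
      exists (fun z => d y z < (a - b) / 4); split; [|exact Hxy].
      apply (in_map (fun x z => d x z < (a - b) / 4)), Hy. }
  assert (Hfine : forall V x y, In V U -> V x -> V y -> d x y < (a - b) / 2).
  { intros V x y HV Hx Hy; apply in_map_iff in HV as (z & <- & _).
    pose proof (dist_tri X d Hmetric x z y).
    rewrite (dist_sym X d Hmetric x z) in *; lra. }
  destruct (choice (fun n k => is_N X (join_elem X T t U n) k)
    (fun n => exists_is_N t U n HU)) as [Nseq HN].
  assert (Hln : 0 < ln 2) by (rewrite <- ln_1; apply ln_increasing; lra).
  (* The square of [Nseq n] is at least [2 ^ length A] and [n <= 2 * length A], so [ln (Nseq n)] is
     at least [n * ln 2 / 4]. *)
  destruct (Hnull t Ht U HU Nseq HN (ln 2 / 4)) as [N0 HN0]; [lra|].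
  destruct (Hblocks N0) as (n & A & Hn & HA & Hnd & [Hn0 HnA] & HAt).
  specialize (HN0 n Hn).
  destruct (HN n) as [(L & HL & HLj & HLc) _].
  assert (Hcard := independent_card_le a b A t U n L HA Hnd HAt Hfine HLj HLc).
  rewrite HL in Hcard.
  assert (Hk : (0 < Nseq n)%nat).
  { destruct (Nseq n); [|lia]. pose proof (Nat.pow_nonzero 2 (length A)); lia. }
  apply lt_INR in Hk; simpl in Hk.
  apply le_INR in Hcard; rewrite pow_INR, mult_INR in Hcard; change (INR 2) with 2 in Hcard.
  assert (Hlog : INR (length A) * ln 2 <= ln (INR (Nseq n)) + ln (INR (Nseq n))).
  { rewrite <- ln_mult, <- ln_pow by lra.
    destruct Hcard as [Hc| ->]; [left; apply ln_increasing; [apply pow_lt; lra|assumption]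
      |right; reflexivity]. }
  apply le_INR in HnA; rewrite mult_INR in HnA; change (INR 2) with 2 in HnA.
  apply lt_INR in Hn0; simpl in Hn0.
  apply (Rmult_lt_compat_l (INR n)) in HN0; [|assumption].
  rewrite <- Rmult_assoc, Rinv_r, Rmult_1_l in HN0 by lra.
  assert (INR n * ln 2 <= 2 * INR (length A) * ln 2) by (apply Rmult_le_compat_r; lra).
  lra.
Qed.

(** A Markov-type estimate: in an average above [eps / 2], times with distance at most [eps / 4]
    account for at most [eps / 4]. The others contribute at most [D] each, so their density is at
    least [eps / 4 / D]. *)
Lemma not_mean_equicontinuous_often : ~ mean_equicontinuous X d T ->
  exists eps c, 0 < eps /\ 0 < c /\ often X d T eps [] c.
Proof.
  intros H; apply not_all_ex_not in H as [eps H].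
  apply imply_to_and in H as [Heps H].
  destruct (dist_bounded X d Hmetric Hcompact) as (D & HD & Hbd).
  exists (eps / 4), (eps / 4 / D).
  assert (Hc : 0 < eps / 4 / D) by (apply Rdiv_lt_0_compat; lra).
  split; [lra|]; split; [assumption|]; intros delta Hdelta.
  apply NNPP; intros Hno; apply H; exists delta; split; [assumption|]; intros x y Hxy.
  apply NNPP; intros Hlim; apply Hno; exists x, y; split; [assumption|]; intros N0.
  (* [limsup_lt] wants an eventual bound strictly below [eps]; failure of [eps / 2] already
     suffices. *)
  apply NNPP; intros HN; apply Hlim; exists (eps / 2); split; [lra|].
  exists (S N0); intros n Hn; apply Rnot_lt_le; intros Hlt; apply HN; exists n.
  split; [lia|]; simpl.
  assert (Hn0 : 0 < INR n) by (apply (lt_INR 0); lia).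
  set (S1 := rsum (fun i => ind (eps / 4 < d (it i x) (it i y))) n).
  assert (Hsum : rsum (fun i => d (it i x) (it i y)) n <= INR n * (eps / 4) + D * S1).
  { unfold S1; rewrite <- rsum_const, <- rsum_scal, <- rsum_plus.
    apply rsum_le; intros i.
    destruct (Rlt_dec (eps / 4) (d (it i x) (it i y))) as [Hi|Hi];
      [rewrite ind_true by assumption; pose proof (Hbd (it i x) (it i y)); lra
      |rewrite ind_false by assumption; lra]. }
  apply (Rmult_lt_compat_l (INR n)) in Hlt; [|assumption].
  rewrite <- Rmult_assoc, Rinv_r, Rmult_1_l in Hlt by lra.
  apply (Rmult_le_reg_l D); [assumption|].
  replace (D * (eps / 4 / D * INR n)) with (eps / 4 * INR n) by (field; lra).
  lra.
Qed.

End Entropy.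

Theorem mainTheorem8 (X : Type) (d : X -> X -> R) (T : X -> X)
  (Hmetric : is_metric X d) (Hcompact : is_compact X d)
  (Hcont : continuous_map X d T)
  (Hnull : null_system X d T)
  (Hdense : minimal_points_dense X d T) :
  mean_equicontinuous X d T.
Proof.
  apply NNPP; intros Hnot.
  destruct (not_mean_equicontinuous_often X d T Hmetric Hcompact Hnot)
    as (eps & c & Heps & Hc & Hoften).
  (* Far then means above 7/8 of [eps] and close below 3/8 of [eps], which leaves a gap. *)
  set (theta := eps / 8).
  apply (null_independent_bounded X d T Hmetric Hcompact (eps - theta) (eps / 4 + theta) Hnull);
    [unfold theta; lra|].
  intros n.
  (* One pair for each word of length [n], as the duality requires. *)
  destruct (exists_shattered X d T Hmetric Hcompact Hcont Hdense eps (eps / 4) c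
    ltac:(lra) Hc Hoften (2 ^ n) theta ltac:(unfold theta; lra))
    as (ab & ws & c' & Hab & _ & _ & Hsh).
  apply (shattered_independent X d T eps (eps / 4) n theta ab ws Hab Hsh).
  unfold theta; lra.
Qed.
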